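(* Let $\beta_0=\frac{q_0}{q_0-p_0}>1$ have Hirzebruch-Jung continued fraction expansion $\beta_0=[[b_1,\ldots,b_s]]$ with integers $b_j\ge 2$, and put $\beta_j=[[b_{j+1},\ldots,b_s]]$ for $0\le j\le s-1$. Then $b_{j+1}=\lceil \beta_j\rceil$ for every $0\le j\le s-1$.
   Context: Here $p_0,q_0$ are relatively prime integers with $0\le p_0<q_0$ and $\beta_0=\frac{q_0}{q_0-p_0}>1$. For integers $c_1,\ldots,c_t\ge 2$ ($t\ge 1$), the Hirzebruch-Jung continued fraction is $[[c_1,\ldots,c_t]]=c_1-\cfrac{1}{c_2-\cfrac{1}{\ddots-\cfrac{1}{c_t}}}$; equivalently $[[c_1]]=c_1$ and $[[c_1,\ldots,c_t]]=c_1-\frac{1}{[[c_2,\ldots,c_t]]}$ for $t\ge 2$. The Hirzebruch-Jung expansion of a rational number $>1$ is its expression in this form with all $c_i\geq 2$ integers. *)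

(* Defs.v *)
From mathcomp Require Import all_boot all_order all_algebra.

Set Implicit Arguments.
Unset Strict Implicit.
Unset Printing Implicit Defensive.

Import Order.TTheory GRing.Theory Num.Theory.
Local Open Scope ring_scope.

(* [[c_1, ..., c_t]]; the value 0 on the empty sequence is junk. *)
Fixpoint hj_cfrac (c : seq int) : rat :=
  match c with
  | [::] => 0
  | [:: c1] => c1%:~R
  | c1 :: c' => c1%:~R - 1 / hj_cfrac c'
  end.

Definition is_hj_expansion (x : rat) (c : seq int) : Prop :=
  [/\ c <> [::], (forall ci : int, ci \in c -> 2 <= ci) & x = hj_cfrac c].

(* Main.v *)
(* The tail [[c_2, ..., c_t]] exceeds 1 by induction, so its inverse lies in
   [0, 1) and c_1 - 1 < [[c_1, ..., c_t]] <= c_1. *)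
Require Import Defs.
From mathcomp Require Import all_boot all_order all_algebra.
Import Order.TTheory GRing.Theory Num.Theory.
Local Open Scope ring_scope.

(** Entries at least 2 keep the fraction above 1 ([hj_cfrac_gt1]): inductively, the head loses less
    than 1. So rounding up recovers the head ([ceil_hj_cfrac]). Every tail of the expansion inherits
    the bound on its entries, which gives all the digits. *)

Lemma hj_cfrac_gt1 (c : seq int) :
  c <> [::] -> (forall ci : int, ci \in c -> 2 <= ci) -> 1 < hj_cfrac c.
Proof.
elim: c => [//|c1 [|c2 c] IHc] _ c_ge2.
  by rewrite /= ltr1z; apply: lt_le_trans (c_ge2 _ (mem_head _ _)).
have tail_gt1 : 1 < hj_cfrac (c2 :: c).
  by apply: IHc => // ci c_ci; apply: c_ge2; rewrite in_cons c_ci orbT.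
have c1_ge2 : 2 <= c1%:~R :> rat by rewrite (ler_int _ 2) c_ge2 ?mem_head.
(* Conversion exposes a single level, leaving the tail folded as in [tail_gt1]. *)
rewrite [hj_cfrac _]/(c1%:~R - 1 / hj_cfrac (c2 :: c)) div1r ltrBrDr.
apply: lt_le_trans c1_ge2.
by rewrite -[ltRHS]/(1 + 1) ltrD2l invf_lt1 // (lt_trans ltr01).
Qed.

Lemma ceil_hj_cfrac (c1 : int) (c : seq int) :
  (forall ci : int, ci \in c -> 2 <= ci) ->
  Num.ceil (hj_cfrac (c1 :: c)) = c1.
Proof.
case: c => [|c2 c] c_ge2; first by rewrite /= intrKceil.
have tail_gt1 : 1 < hj_cfrac (c2 :: c) by exact: hj_cfrac_gt1.
have tail_gt0 := lt_trans ltr01 tail_gt1.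
apply: ceil_def.
rewrite [hj_cfrac _]/(c1%:~R - 1 / hj_cfrac (c2 :: c)) div1r rmorphB /=.
by rewrite ltrD2l ltrN2 invf_lt1 // tail_gt1 gerBl invr_ge0 ltW.
Qed.

Theorem theorem2p2 (p0 q0 : int) (b : seq int)
    (hcop : coprimez p0 q0) (hpq : 0 <= p0 < q0)
    (hbeta0 : 1 < q0%:~R / (q0 - p0)%:~R :> rat)
    (hb : is_hj_expansion (q0%:~R / (q0 - p0)%:~R) b) :
  forall j : nat, (j < size b)%N ->
    b`_j = Num.ceil (hj_cfrac (drop j b)).
Proof.
move=> j lt_j_b; case: hb => _ b_ge2 _.
rewrite (drop_nth 0 lt_j_b) ceil_hj_cfrac // => ci /mem_drop.
exact: b_ge2.
Qed.
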